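(* Let $q_1,q_2>1$ be integers and let $\chi_1,\chi_2$ be primitive Dirichlet characters modulo $q_1$ and $q_2$ respectively such that $\chi_1\chi_2(-1)=1$. Put $\psi=\chi_1\overline{\chi_2}$, a Dirichlet character modulo $q_1q_2$. For all $h,k,n\in\mathbb{Z}$ with $q_1q_2\mid k$ and $n,k>0$, $$\sum_{\substack{ad=n\\ (a,q_1q_2)=1}}\psi(a)\sum_{b \bmod d}S_{\chi_1,\chi_2}(ah+bk,\,dk)=\rho_{\chi_1,\chi_2}(n)\,S_{\chi_1,\chi_2}(h,k),$$ where $a,d$ run over positive integers with $ad=n$, and $$\rho_{\chi_1,\chi_2}(n)=\sum_{d\mid n}\chi_1\!\left(\frac nd\right)\overline{\chi_2}(d)\,d .$$
   Context: $B_1(x)=0$ if $x\in\mathbb{Z}$ and $B_1(x)=x-\lfloor x\rfloor-\tfrac12$ otherwise. For $h\in\mathbb{Z}$ and a positive integer $k$ divisible by $q_1q_2$ (no coprimality of $h$ and $k$ is required), the newform Dedekind sum is $$S_{\chi_1,\chi_2}(h,k)=\sum_{j \bmod k}\ \sum_{n \bmod q_1}\overline{\chi_2}(j)\,\overline{\chi_1}(n)\,B_1\!\left(\tfrac{j}{k}\right)B_1\!\left(\tfrac{n}{q_1}+\tfrac{hj}{k}\right).$$ *)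

(* Defs.v *)
From HB Require Import structures.
From mathcomp Require Import all_boot all_order all_algebra.
From mathcomp Require Import reals complex.

Set Implicit Arguments.
Unset Strict Implicit.
Unset Printing Implicit Defensive.

Import Order.TTheory GRing.Theory Num.Theory.
Local Open Scope ring_scope.
Local Open Scope complex_scope.

(* Dirichlet characters modulo q > 0, extended by 0 to all of Z.
   chi 1 = 1 follows from the second and third conditions. *)
Definition dirichlet_character (R : realType) (q : nat) (chi : int -> R[i]) :
    Prop :=
  [/\ forall a : int, chi (a + q%:Z) = chi a,
      forall a b : int, chi (a * b) = chi a * chi b
    & forall a : int, (chi a != 0) = coprimez a q%:Z].

Definition induced_from (R : realType) (q : nat) (chi : int -> R[i])
    (d : nat) : Prop :=
  exists chi' : int -> R[i], dirichlet_character d chi' /\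
    forall a : int, coprimez a q%:Z -> chi a = chi' a.

Definition primitive_character (R : realType) (q : nat) (chi : int -> R[i]) :
    Prop :=
  dirichlet_character q chi /\
  forall d : nat, (d %| q)%N -> induced_from q chi d -> d = q.

Definition B1 (R : realType) (x : R) : R :=
  if x \is a Num.int then 0 else x - (Num.floor x)%:~R - 2^-1.

Definition dedekind_sum (R : realType) (q1 : nat) (chi1 chi2 : int -> R[i])
    (h : int) (k : nat) : R[i] :=
  \sum_(j < k) \sum_(n < q1)
    (chi2 j%:Z)^* * (chi1 n%:Z)^*
    * (B1 (j%:R / k%:R : R))%:C
    * (B1 (n%:R / q1%:R + (h * j%:Z)%:~R / k%:R : R))%:C.

Definition psi (R : realType) (chi1 chi2 : int -> R[i]) (a : int) : R[i] :=
  chi1 a * (chi2 a)^*.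

Definition rho (R : realType) (chi1 chi2 : int -> R[i]) (n : nat) : R[i] :=
  \sum_(d <- divisors n) chi1 (n %/ d)%N%:Z * (chi2 d%:Z)^* * d%:R.

(* Main.v *)
(* Let T(y) = sum_(n mod q1) conj chi1(n) B1(n/q1 + y).  The distribution
   relation of B1, together with the primitivity of chi1, gives
     sum_(b mod d) T(x + b/d) = chi1(d) T(d x),
   also when d is not prime to q1.  For g = gcd(j, d) this evaluates the inner
   sum over b as g chi1(d/g) T(a h (j/g) / k).  Sorting by g, the left-hand
   side becomes a combination over a d g = n of the sums
     C(d, a) = sum_(j mod d k, (j, d) = 1) conj chi2(j) B1(j/(d k)) T(a h j/k).
   On the other side, the distribution relation of B1 also gives
     S(h, k) = sum_(j mod d k) conj chi2(j) B1(j/(d k)) T(h j/k)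
   for every d > 0; taking d = n/g in the g-th term of rho(n) S(h, k) and
   sorting by a = gcd(j, n/g) produces the same combination. *)

Require Import Defs.
From mathcomp Require Import all_boot all_order all_algebra.
From mathcomp Require Import reals complex cyclic.
From mathcomp Require Import ring lra.

Import Order.TTheory GRing.Theory Num.Theory.
Local Open Scope ring_scope.
Local Open Scope complex_scope.

(** * Finite sums over residues and over divisors *)

Lemma sum_ord_mul (V : nmodType) (m k : nat) (F : nat -> V) :
  \sum_(j < m * k) F j = \sum_(i < m) \sum_(j < k) F (i * k + j)%N.
Proof.
rewrite -(big_mkord xpredT) big_nat_mul big_mkord; apply: eq_bigr => i _.
rewrite -{1}[(i * k)%N]add0n mulSn big_addn addnK big_mkord.
by apply: eq_bigr => j _; rewrite addnC.
Qed.

Lemma sum_ord_dvdn (V : nmodType) (g m : nat) (F : nat -> V) : (0 < g)%N ->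
  \sum_(j < m * g | (g %| j)%N) F j = \sum_(i < m) F (g * i)%N.
Proof.
move=> g_gt0.
rewrite big_mkcond (sum_ord_mul _ _ _ (fun j => if (g %| j)%N then F j else 0)).
apply: eq_bigr => i _; rewrite (bigD1 (Ordinal g_gt0)) //= addn0 dvdn_mull //.
rewrite big1 ?addr0 1?mulnC // => j; rewrite -val_eqE /= => j0.
by rewrite dvdn_addr ?dvdn_mulr // gtnNdvd ?lt0n.
Qed.

(** The [j] with [gcdn j d = g] are exactly the multiples [g * i] with [i] prime to [d %/ g], and
    [j < d * k] becomes [i < d %/ g * k]. *)
Lemma sum_ord_gcdn (V : nmodType) (d k : nat) (F : nat -> V) : (0 < d)%N ->
  \sum_(j < d * k) F j =
  \sum_(g <- divisors d)
    \sum_(j < d %/ g * k | coprime j (d %/ g)) F (g * j)%N.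
Proof.
move=> d_gt0; transitivity
  (\sum_(j < d * k) \sum_(g <- divisors d | g == gcdn j d) F j).
  apply: eq_bigr => j _.
  rewrite -big_filter filter_pred1_uniq ?divisors_uniq ?big_seq1 //.
  by rewrite -dvdn_divisors // dvdn_gcdr.
rewrite (exchange_big_dep xpredT) //= big_seq [RHS]big_seq.
apply: eq_bigr => g; rewrite -dvdn_divisors // => g_dvd.
have g_gt0 : (0 < g)%N by apply: dvdn_gt0 g_dvd.
have -> : (d * k = d %/ g * k * g)%N by rewrite mulnAC divnK.
transitivity (\sum_(j < d %/ g * k * g | (g %| j)%N)
    if g == gcdn j d then F j else 0).
  rewrite big_mkcond [RHS]big_mkcond; apply: eq_bigr => j _.
  case: eqP => [gE|_]; last by rewrite if_same.
  by have := dvdn_gcdl j d; rewrite -gE => ->.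
rewrite (sum_ord_dvdn _ _ _ (fun j => if g == gcdn j d then F j else 0)) //.
rewrite [RHS]big_mkcond; apply: eq_bigr => j _.
have -> : gcdn (g * j) d = (g * gcdn j (d %/ g))%N.
  by rewrite muln_gcdr [(g * (d %/ g))%N]mulnC divnK.
by rewrite -[X in X == _]muln1 eqn_pmul2l // eq_sym.
Qed.

Lemma sum_divisors_ord (V : nmodType) (N m : nat) (F : nat -> V) :
    (0 < m <= N)%N ->
  \sum_(d <- divisors m) F d = \sum_(d < N.+1 | (d %| m)%N) F d.
Proof.
move=> /andP[m_gt0 le_mN].
rewrite -(big_mkord (fun d => (d %| m)%N)) -[RHS]big_filter; apply: perm_big.
apply: uniq_perm; rewrite ?divisors_uniq ?filter_uniq ?iota_uniq // => d.
rewrite mem_filter mem_index_iota -dvdn_divisors //.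
case: (boolP (d %| m)%N) => //= d_dvd; apply/esym.
by rewrite ltnS (leq_trans (dvdn_leq m_gt0 d_dvd)).
Qed.

(** Both sides run over the pairs with [a * g] dividing [n], a condition symmetric in [a] and [g].
    Ranging over fixed ordinals with this condition makes the exchange possible. *)
Lemma exchange_divisors (V : nmodType) (n : nat) (F : nat -> nat -> V) :
    (0 < n)%N ->
  \sum_(a <- divisors n) \sum_(g <- divisors (n %/ a)) F a g =
  \sum_(g <- divisors n) \sum_(a <- divisors (n %/ g)) F a g.
Proof.
move=> n_gt0.
have toord (G : nat -> nat -> V) :
    \sum_(a <- divisors n) \sum_(g <- divisors (n %/ a)) G a g =
    \sum_(a < n.+1) \sum_(g < n.+1 | (g * a %| n)%N) G a g.
  rewrite (sum_divisors_ord _ n) ?n_gt0 ?leqnn // big_mkcond.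
  apply: eq_bigr => a _; case: ifPn => [a_dvd|a_ndvd].
    rewrite (sum_divisors_ord _ n) ?leq_div //.
      by apply: eq_bigl => g; rewrite dvdn_divRL.
    by rewrite divn_gt0 ?(dvdn_gt0 n_gt0) // dvdn_leq.
  (* If [a] does not divide [n], no multiple [g * a] does, so the inner sum is empty. *)
  rewrite big_pred0 // => g; apply: contraNF a_ndvd.
  exact: dvdn_trans (dvdn_mull _ _).
rewrite toord (toord (fun g a => F a g)) (exchange_big_dep xpredT) //=.
by apply: eq_bigr => g _; apply: eq_bigl => a; rewrite mulnC.
Qed.

(** * Periodic functions on the integers *)

Lemma periodicz (T : Type) (q : nat) (p : int -> T) :
    (forall a, p (a + q%:Z) = p a) ->
  forall a b : int, (q%:Z %| a - b)%Z -> p a = p b.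
Proof.
move=> pq a b /dvdzP[c abE]; rewrite -[a](subrK b) {}abE addrC.
have pn (m : nat) x : p (x + m%:Z * q%:Z) = p x.
  elim: m x => [|m IHm] x; first by rewrite mul0r addr0.
  by rewrite intS mulrDl mul1r addrA IHm pq.
case: c => m; first exact: pn.
by rewrite NegzE mulNr -[in RHS](subrK (m.+1%:Z * q%:Z) b) pn.
Qed.

(** Since [u] is a unit modulo [q], the map [i -> u * i + m] permutes the residues; [s] is this
    permutation on representatives. *)
Lemma sum_periodic_affine (V : nmodType) (q : nat) (p : int -> V) (u m : int) :
    (0 < q)%N -> (forall a, p (a + q%:Z) = p a) -> coprimez u q%:Z ->
  \sum_(i < q) p (u * i%:Z + m) = \sum_(i < q) p i%:Z.
Proof.
move=> q_gt0 pq u_q; have q_neq0 : q%:Z != 0 by rewrite eqz_nat -lt0n.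
have modE (a : int) : (`|(a %% q%:Z)%Z|%N)%:Z = (a %% q%:Z)%Z.
  by rewrite gez0_abs // modz_ge0.
have mod_lt (a : int) : (`|(a %% q%:Z)%Z| < q)%N.
  by rewrite -ltz_nat modE ltz_mod.
pose s (i : 'I_q) := Ordinal (mod_lt (u * i%:Z + m)).
have s_inj : injective s.
  move=> i j /(congr1 (fun k : 'I_q => (nat_of_ord k)%:Z)) /=.
  rewrite !modE => /eqP.
  rewrite eqz_mod_dvd opprD addrACA subrr addr0 -mulrBr.
  rewrite Gauss_dvdzr 1?coprimez_sym // -eqz_mod_dvd => /eqP.
  by rewrite !modz_small ?ltz_nat ?ltn_ord // => -[] /val_inj.
rewrite [RHS](reindex_inj s_inj) /=; apply: eq_bigr => i _.
apply: (periodicz _ _ _ pq); rewrite modE.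
by rewrite -eqz_mod_dvd modz_mod.
Qed.

Lemma sum_periodic_mul (V : nmodType) (q g : nat) (p : int -> V) :
    (forall a, p (a + q%:Z) = p a) ->
  \sum_(i < g * q) p i%:Z = (\sum_(i < q) p i%:Z) *+ g.
Proof.
move=> pq; rewrite (sum_ord_mul _ _ _ (fun i : nat => p i%:Z)).
rewrite -[g in RHS]card_ord -sumr_const; apply: eq_bigr => i _.
apply: eq_bigr => j _; apply: (periodicz _ _ _ pq).
by rewrite PoszD PoszM addrK dvdz_mull.
Qed.

(** * The function [B1] and its distribution relation *)

Lemma B1_addz (R : realType) (x : R) (m : int) : B1 (x + m%:~R) = B1 x.
Proof.
rewrite /B1 rpredDr ?intr_int // floorDrz ?intr_int // intrKfloor intrD.
by case: ifP => // _; ring.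
Qed.

Lemma sum_natr_ord (R : realType) (f : nat) :
  \sum_(i < f) (i%:R : R) = f%:R * (f%:R - 1) / 2.
Proof.
elim: f => [|f IHf]; first by rewrite big_ord0 !mul0r.
by rewrite big_ord_recr /= IHf -(natr1 f); field.
Qed.

Lemma B1_frac (R : realType) (x : R) : 0 < x < 1 -> B1 x = x - 2^-1.
Proof.
move=> /andP[x_gt0 x_lt1]; have fx : Num.floor x = 0.
  by apply: floor_def; rewrite add0r x_lt1 ltW.
by rewrite /B1 intrEfloor fx eq_sym gt_eqF // subr0.
Qed.

(* Both sides are invariant under x -> x + 1/f, which reduces the claim to
   0 <= x < 1/f, where B1 is explicit; x = 0 is special since B1 jumps there. *)
Lemma sum_B1 (R : realType) (f : nat) (x : R) : (0 < f)%N ->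
  \sum_(i < f) B1 (x + i%:R / f%:R) = B1 (f%:R * x).
Proof.
move=> f_gt0; have f0 : (f%:R : R) != 0 by rewrite pnatr_eq0 -lt0n.
have fR_gt0 : 0 < (f%:R : R) by rewrite ltr0n.
pose m := Num.floor (f%:R * x); pose y := x - m%:~R / f%:R.
have xE : x = y + m%:~R / f%:R by rewrite subrK.
have fyE : f%:R * x = f%:R * y + m%:~R by rewrite xE; field.
have fy_ge0 : 0 <= f%:R * y.
  by have := floor_le (f%:R * x); rewrite -/m fyE; lra.
have fy_lt1 : f%:R * y < 1.
  by have := floorD1_gt (f%:R * x); rewrite -/m fyE intrD; lra.
rewrite fyE B1_addz.
pose p (a : int) : R := B1 (y + a%:~R / f%:R).
transitivity (\sum_(i < f) p (1 * i%:Z + m)).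
  apply: eq_bigr => i _; rewrite /p mul1r intrD {1}xE; congr B1.
  by rewrite -pmulrn; field.
rewrite (sum_periodic_affine _ f p) ?/coprimez ?gcd1z //; last first.
  by move=> a; rewrite /p intrD mulrDl -pmulrn divff // addrA (B1_addz _ _ 1).
rewrite /p {p}; under eq_bigr do rewrite -pmulrn.
have [y0|y_neq0] := eqVneq (f%:R * y) 0.
  have {}y0 : y = 0 by apply/(mulfI f0); rewrite y0 mulr0.
  rewrite y0 mulr0.
  case: f f_gt0 f0 fR_gt0 {m xE fyE fy_ge0 fy_lt1 y0 y} => // f _ f0 fR_gt0.
  rewrite big_ord_recl /= mul0r addr0 /B1 rpred0 add0r.
  (* The modulus is now [f.+1]. The term at 0 is gone because [B1 0 = 0], and the other [f]
     arguments lie strictly between 0 and 1. *)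
  transitivity (\sum_(i < f) ((i%:R + 1) / f.+1%:R - 2^-1 : R)).
    apply: eq_bigr => i _; rewrite /bump leq0n add1n add0r natr1.
    rewrite -/(B1 _) B1_frac // ?divr_gt0 ?ltr0n //=.
    by rewrite ltr_pdivrMr // mul1r ltr_nat ltnS ltn_ord.
  rewrite sumrB -mulr_suml big_split /= sum_natr_ord !sumr_const card_ord.
  rewrite -[2^-1 *+ f]mulr_natl; move: f0; rewrite -(natr1 f) => f0.
  by field.
have fy_gt0 : 0 < f%:R * y by rewrite lt_neqAle eq_sym y_neq0.
have y_gt0 : 0 < y by rewrite -(pmulr_rgt0 _ fR_gt0).
rewrite [RHS]B1_frac ?fy_gt0 //.
transitivity (\sum_(i < f) (y - 2^-1 + i%:R / f%:R)).
  apply: eq_bigr => i _; rewrite B1_frac; first by ring.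
  rewrite ltr_pwDl ?divr_ge0 ?ler0n //= -(ltr_pM2l fR_gt0) mulr1 mulrDr.
  rewrite [f%:R * (_ / _)]mulrC divfK //.
  have : (i.+1%:R : R) <= f%:R by rewrite ler_nat ltn_ord.
  by rewrite -natr1; lra.
rewrite big_split /= -mulr_suml sum_natr_ord sumr_const card_ord -mulr_natl.
by field.
Qed.

(** * Dirichlet characters and primitivity *)

Lemma dirichlet_character1 (R : realType) (q : nat) (chi : int -> R[i]) :
  dirichlet_character q chi -> chi 1 = 1.
Proof.
case=> _ chiM chi0; have c0 : chi 1 != 0 by rewrite chi0 /coprimez gcd1z.
by apply: (mulfI c0); rewrite -chiM !mulr1.
Qed.

Lemma dirichlet_character_mod (R : realType) (q : nat) (chi : int -> R[i]) :
  dirichlet_character q chi ->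
  forall a b : int, (q%:Z %| a - b)%Z -> chi a = chi b.
Proof. by case=> chiq _ _; apply: periodicz. Qed.

(** By Euler's theorem [chi a] is a root of unity of order dividing [totient q], hence has modulus
    1. *)
Lemma dirichlet_character_conj (R : realType) (q : nat) (chi : int -> R[i])
    (a : int) : (0 < q)%N -> dirichlet_character q chi -> coprimez a q%:Z ->
  chi a * (chi a)^* = 1.
Proof.
move=> q_gt0 chiP a_q; have [chiq chiM chi0] := chiP.
have q_neq0 : q%:Z != 0 by rewrite eqz_nat -lt0n.
pose r := `|(a %% q%:Z)%Z|%N.
have rE : r%:Z = (a %% q%:Z)%Z by rewrite gez0_abs // modz_ge0.
have chir : chi a = chi r%:Z.
  apply: (dirichlet_character_mod _ _ _ chiP).
  by rewrite -eqz_mod_dvd rE modz_mod.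
have r_q : coprime r q.
  by rewrite -[coprime r q]/(coprimez r%:Z q%:Z) -chi0 -chir chi0.
have chiX (t : nat) : chi (r ^ t)%N%:Z = chi a ^+ t.
  elim: t => [|t IHt]; first by rewrite expn0 (dirichlet_character1 _ _ _ chiP).
  by rewrite expnS PoszM chiM IHt -chir exprS.
have chi_tot : chi a ^+ totient q = 1.
  rewrite -chiX -(dirichlet_character1 _ _ _ chiP).
  apply: (dirichlet_character_mod _ _ _ chiP); rewrite -eqz_mod_dvd.
  by rewrite !modz_nat; apply/eqP; rewrite (Euler_exp_totient r_q).
rewrite -sqr_normc; have : `|chi a| ^+ totient q == 1.
  by rewrite -normrX chi_tot normr1.
by rewrite pexpr_eq1 ?totient_gt0 // => /eqP ->; rewrite expr1n.
Qed.

(** This is the surjectivity of reduction from units modulo [q] to units modulo [d], obtained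
    without the Chinese remainder theorem. *)
Lemma coprimez_lift (q d : nat) (a : int) :
    (0 < q)%N -> (d %| q)%N -> coprimez a d%:Z ->
  exists b : int, (d%:Z %| b - a)%Z /\ coprimez b q%:Z.
Proof.
move=> q_gt0 d_q a_d; have d_gt0 := dvdn_gt0 q_gt0 d_q.
have d_neq0 : d%:Z != 0 by rewrite eqz_nat -lt0n.
(* Adding [d] keeps [r] positive, so that [\pi(r)] is the set of its prime divisors even when the
   residue is 0. *)
pose r := (`|(a %% d%:Z)%Z| + d)%N.
have rE : r%:Z = (a %% d%:Z)%Z + d%:Z by rewrite PoszD gez0_abs // modz_ge0.
have ra : (r%:Z = a %[mod d%:Z])%Z by rewrite rE modzDr modz_mod.
have r_gt0 : (0 < r)%N by rewrite addn_gt0 d_gt0 orbT.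
have r_d : coprime r d.
  rewrite -[coprime r d]/(coprimez r%:Z d%:Z) /coprimez -gcdz_modl ra gcdz_modl.
  exact: a_d.
(* Each prime [p] dividing [q] divides exactly one summand. If [p] divides [r], it divides neither
   [d], which is prime to [r], nor the part of [q] prime to [r]; otherwise it divides that part. *)
exists (r + d * q`_\pi(r)^')%N%:Z; split.
  by rewrite -eqz_mod_dvd PoszD PoszM addrC mulrC modzMDl ra.
rewrite -[coprimez _ _]/(coprime _ _) coprime_has_primes //; last first.
  by rewrite addn_gt0 r_gt0.
apply/hasPn => p; rewrite mem_primes => /and3P[p_pr _ p_q].
rewrite mem_primes p_pr addn_gt0 r_gt0 /=.
have p_part (rho : nat_pred) : (p %| q`_rho)%N = (p \in rho).
  have := pi_of_part rho q_gt0 p.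
  by rewrite !inE !mem_primes p_pr q_gt0 p_q part_gt0.
have [p_r|p_r] := boolP (p %| r)%N; last first.
  by rewrite dvdn_addl // dvdn_mull // p_part !inE mem_primes p_pr r_gt0.
rewrite dvdn_addr // Euclid_dvdM // negb_or -prime_coprime //.
by rewrite (coprime_dvdl p_r) //= p_part !inE mem_primes p_pr r_gt0 p_r.
Qed.

(** A character trivial on the units congruent to 1 modulo [d] factors through the units modulo [d],
    so it is induced from [d]; primitivity then leaves only [d = q]. *)
Lemma primitive_character_nontrivial (R : realType) (q d : nat)
    (chi : int -> R[i]) :
    (0 < q)%N -> primitive_character q chi -> (d %| q)%N ->
    (forall u : int, (d%:Z %| u - 1)%Z -> coprimez u q%:Z -> chi u = 1) ->
  d = q.
Proof.
move=> q_gt0 [chiP primP] d_q triv; apply: primP => //.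
have [chiq chiM chi0] := chiP.
have chi_d (x y : int) : (d%:Z %| x - y)%Z -> coprimez x q%:Z ->
    coprimez y q%:Z -> chi x = chi y.
  (* With [w] an inverse of [y] modulo [q], both [x * w] and [y * w] are units congruent to 1 modulo
     [d], where [chi] is trivial; [chi w] then cancels. *)
  move=> xy_d x_q y_q; have /coprimezP[[w v] /= wv] := y_q.
  have w_q : coprimez w q%:Z.
    by apply/coprimezP; exists (y, v); rewrite /= mulrC.
  have w0 : chi w != 0 by rewrite chi0.
  apply: (mulIf w0); rewrite -!chiM.
  have dz_q : (d%:Z %| q%:Z)%Z by [].
  have yw1 : (d%:Z %| y * w - 1)%Z.
    by rewrite -wv mulrC opprD addrA subrr sub0r rpredN dvdz_mull.
  rewrite !triv // ?coprimezMl ?x_q ?y_q //.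
  have -> : x * w - 1 = (x - y) * w + (y * w - 1) by ring.
  by rewrite rpredD // dvdz_mulr.
(* The boolean implication makes the existence total in [a], so [xchoose] yields a lift for every
   integer; the lift is arbitrary off the units modulo [d]. *)
have liftP a : exists b : int,
    coprimez a d%:Z ==> (d%:Z %| b - a)%Z && coprimez b q%:Z.
  have [a_d|] := boolP (coprimez a d%:Z); last by exists 0.
  have [b [b1 b2]] := coprimez_lift _ _ _ q_gt0 d_q a_d.
  by exists b; rewrite b1.
pose lift a := xchoose (liftP a).
have lift_d a : coprimez a d%:Z -> (d%:Z %| lift a - a)%Z.
  by move=> a_d; have /implyP/(_ a_d)/andP[] := xchooseP (liftP a).
have lift_q a : coprimez a d%:Z -> coprimez (lift a) q%:Z.
  by move=> a_d; have /implyP/(_ a_d)/andP[] := xchooseP (liftP a).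
have chi_lift a b : coprimez a d%:Z -> coprimez b q%:Z -> (d%:Z %| b - a)%Z ->
    chi (lift a) = chi b.
  move=> a_d b_q ba_d; apply: chi_d => //; last exact: lift_q.
  have -> : lift a - b = (lift a - a) - (b - a) by ring.
  by rewrite rpredB // lift_d.
exists (fun a => if coprimez a d%:Z then chi (lift a) else 0).
split; last first.
  move=> a a_q; have a_d : coprimez a d%:Z by apply: coprimez_dvdr a_q.
  by rewrite a_d (chi_lift a a) // subrr dvdz0.
split=> [a|a b|a].
- have -> : coprimez (a + d%:Z) d%:Z = coprimez a d%:Z.
    by rewrite /coprimez -gcdz_modl modzDr gcdz_modl.
  case: ifP => // a_d; apply/esym/chi_lift => //.
    by apply: lift_q; rewrite /coprimez -gcdz_modl modzDr gcdz_modl.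
  have -> : lift (a + d%:Z) - a = (lift (a + d%:Z) - (a + d%:Z)) + d%:Z by ring.
  rewrite rpredD ?dvdzz // lift_d //.
  by rewrite /coprimez -gcdz_modl modzDr gcdz_modl.
- rewrite coprimezMl; case: ifP => [/andP[a_d b_d]|/negbT]; last first.
    by rewrite negb_and => /orP[] /negPf ->; rewrite ?mulr0 ?mul0r.
  rewrite a_d b_d -chiM; apply: chi_lift.
  + by rewrite coprimezMl a_d.
  + by rewrite coprimezMl !lift_q.
  have -> : lift a * lift b - a * b =
      (lift a - a) * lift b + a * (lift b - b) by ring.
  by apply: rpredD; [apply: dvdz_mulr | apply: dvdz_mull]; apply: lift_d.
- case: ifP => [a_d|_]; last by rewrite eqxx.
  by rewrite chi0 lift_q.
Qed.

(** For [m] prime to [q], substitute [i -> m * i] and use that [chi m] has modulus 1. Otherwise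
    [chi m = 0], and primitivity forces the left-hand sum to vanish. *)
Lemma primitive_sum_mul (R : realType) (q m : nat) (chi F : int -> R[i]) :
    (0 < q)%N -> primitive_character q chi -> (forall a, F (a + q%:Z) = F a) ->
  \sum_(i < q) (chi i%:Z)^* * F (m%:Z * i%:Z) =
  chi m%:Z * \sum_(i < q) (chi i%:Z)^* * F i%:Z.
Proof.
move=> q_gt0 prim Fq; have [chiP _] := prim; have [chiq chiM chi0] := chiP.
have FqM c (a : int) : F (c * (a + q%:Z)) = F (c * a).
  apply: (periodicz _ _ _ Fq); rewrite mulrDr addrC addKr; exact: dvdz_mull.
have [m_q|] := boolP (coprimez m%:Z q%:Z).
  rewrite -(sum_periodic_affine _ q (fun a => (chi a)^* * F a) m%:Z 0) //.
    rewrite mulr_sumr; apply: eq_bigr => i _.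
    rewrite addr0 chiM (rmorphM (@conjc R)) !mulrA.
    by rewrite (dirichlet_character_conj _ _ _ _ q_gt0 chiP m_q) mul1r.
  by move=> a; rewrite chiq Fq.
move=> m_q; have cm0 : chi m%:Z = 0.
  by apply/eqP; rewrite -[_ == _]negbK chi0 (negPf m_q).
rewrite cm0 mul0r; apply/eqP/contraT => S_neq0.
(* i -> F (m * i) has period q / g, so the substitution i -> u * i with
   u = 1 mod q / g multiplies the sum by conj chi(u). *)
pose g := gcdn m q; have g_q : (g %| q)%N by rewrite dvdn_gcdr.
have d_q : (q %/ g %| q)%N by rewrite -{2}(divnK g_q) dvdn_mulr.
have g_gt0 : (0 < g)%N by rewrite gcdn_gt0 q_gt0 orbT.
(* This equality means [g = 1], contradicting that [m] is not prime to [q]. *)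
suff dE : (q %/ g = q)%N.
  move: m_q; rewrite -[coprimez _ _]/(g == 1%N).
  by rewrite -(eqn_pmul2l q_gt0) muln1 -{1}dE divnK // eqxx.
apply: (primitive_character_nontrivial _ _ _ _ q_gt0 prim d_q) => u u_d u_q.
have : (chi u)^* = 1.
  apply: (mulIf S_neq0); rewrite mul1r.
  pose p a := (chi a)^* * F (m%:Z * a).
  have pq a : p (a + q%:Z) = p a by rewrite /p chiq FqM.
  rewrite -[RHS](sum_periodic_affine _ q p u 0) // /p.
  rewrite mulr_sumr; apply: eq_bigr => i _.
  rewrite addr0 chiM (rmorphM (@conjc R)) -[RHS]mulrA; congr (_ * (_ * _)).
  apply: (periodicz _ _ _ Fq).
  have -> : m%:Z * i%:Z - m%:Z * (u * i%:Z) = - ((m%:Z * (u - 1)) * i%:Z).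
    by ring.
  rewrite rpredN dvdz_mulr //.
  rewrite -(divnK g_q) PoszM mulrC dvdz_mul //; exact: dvdn_gcdl.
by move/(congr1 (@conjc R)); rewrite conjcK conjc1.
Qed.

(** * The inner sum T, which alone carries the dependence on [h], and its distribution relation *)

Definition twisted_B1 (R : realType) (q : nat) (chi : int -> R[i]) (y : R) :
    R[i] :=
  \sum_(n < q) (chi n%:Z)^* * (B1 (n%:R / q%:R + y))%:C.

Lemma twisted_B1_addz (R : realType) (q : nat) (chi : int -> R[i]) (y : R)
    (m : int) : twisted_B1 R q chi (y + m%:~R) = twisted_B1 R q chi y.
Proof. by apply: eq_bigr => n _; rewrite addrA B1_addz. Qed.

(** For fixed [n] the distribution relation of [B1] gives [B1 (f * n / q + f * x)];
    [primitive_sum_mul] then trades the factor [f] on [n] for [chi f]. *)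
Lemma sum_twisted_B1 (R : realType) (q f : nat) (chi : int -> R[i]) (x : R) :
    (0 < q)%N -> (0 < f)%N -> primitive_character q chi ->
  \sum_(b < f) twisted_B1 R q chi (x + b%:R / f%:R) =
  chi f%:Z * twisted_B1 R q chi (f%:R * x).
Proof.
move=> q_gt0 f_gt0 prim; rewrite exchange_big /=.
have q0 : (q%:R : R) != 0 by rewrite pnatr_eq0 -lt0n.
pose F (a : int) : R[i] := (B1 (a%:~R / q%:R + f%:R * x))%:C.
transitivity (\sum_(n < q) (chi n%:Z)^* * F (f%:Z * n%:Z)).
  apply: eq_bigr => n _; rewrite -mulr_sumr; congr (_ * _).
  rewrite -(rmorph_sum (real_complex R)) /F; congr (_%:C).
  rewrite intrM -!pmulrn -mulrA -mulrDr -sum_B1 //.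
  by apply: eq_bigr => b _; rewrite addrA.
rewrite (primitive_sum_mul _ _ _ _ _ q_gt0 prim) //.
move=> a; rewrite /F intrD mulrDl -[q%:~R]pmulrn divff // addrAC.
by rewrite (B1_addz _ _ 1).
Qed.

(** In lowest terms [j / d = j' / f], with [j'] a unit modulo [f]. As [b] runs below [d = g * f],
    [b * j'] meets each residue modulo [f] exactly [g] times. *)
Lemma sum_twisted_B1_gcdn (R : realType) (q d j : nat) (chi : int -> R[i])
    (x : R) :
    (0 < q)%N -> (0 < d)%N -> primitive_character q chi ->
  \sum_(b < d) twisted_B1 R q chi (x + (b * j)%:R / d%:R) =
  (gcdn j d)%:R * chi (d %/ gcdn j d)%N%:Z
  * twisted_B1 R q chi ((d %/ gcdn j d)%:R * x).
Proof.
move=> q_gt0 d_gt0 prim; set g := gcdn j d.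
have g_gt0 : (0 < g)%N by rewrite gcdn_gt0 d_gt0 orbT.
have gd : (g %| d)%N by rewrite dvdn_gcdr.
have gj : (g %| j)%N by rewrite dvdn_gcdl.
set f := (d %/ g)%N; have dE : d = (g * f)%N by rewrite mulnC divnK.
have f_gt0 : (0 < f)%N by rewrite divn_gt0 // dvdn_leq.
set j' := (j %/ g)%N; have jE : j = (g * j')%N by rewrite mulnC divnK.
have j'_f : coprime j' f.
  by rewrite /coprime -(eqn_pmul2l g_gt0) muln_gcdr -jE -dE muln1.
have f0 : (f%:R : R) != 0 by rewrite pnatr_eq0 -lt0n.
have g0 : (g%:R : R) != 0 by rewrite pnatr_eq0 -lt0n.
pose p (a : int) := twisted_B1 R q chi (x + a%:~R / f%:R).
have pf a : p (a + f%:Z) = p a.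
  rewrite /p intrD mulrDl -[f%:~R]pmulrn divff // addrA.
  exact: (twisted_B1_addz _ _ _ _ 1).
have pfM c a : p (c * (a + f%:Z)) = p (c * a).
  by apply: (periodicz _ _ _ pf); rewrite mulrDr addrC addKr dvdz_mull.
rewrite -[_%:R * _ * _]mulrA -(sum_twisted_B1 _ _ _ _ _ q_gt0 f_gt0 prim).
rewrite mulr_natl.
transitivity (\sum_(b < g * f) p (j'%:Z * b%:Z)).
  rewrite -dE; apply: eq_bigr => b _; rewrite /p; rewrite natrM.
  congr (twisted_B1 _ _ _ (_ + _)).
  have -> : (j%:R : R) = g%:R * j'%:R by rewrite -natrM -jE.
  have -> : (d%:R : R) = g%:R * f%:R by rewrite -natrM -dE.
  rewrite intrM -!pmulrn; field.
  by rewrite f0 g0.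
rewrite (sum_periodic_mul _ f g (fun a => p (j'%:Z * a))) //; congr (_ *+ _).
transitivity (\sum_(b < f) p (j'%:Z * b%:Z + 0)).
  by apply: eq_bigr => b _; rewrite addr0.
by rewrite (sum_periodic_affine _ f p).
Qed.

(** * Dedekind sums expanded in the sums C(d, a) *)

Lemma dedekind_sumE (R : realType) (q1 : nat) (chi1 chi2 : int -> R[i])
    (h : int) (k : nat) :
  dedekind_sum q1 chi1 chi2 h k =
  \sum_(j < k) (chi2 j%:Z)^* * (B1 (j%:R / k%:R : R))%:C
               * twisted_B1 R q1 chi1 ((h * j%:Z)%:~R / k%:R).
Proof.
apply: eq_bigr => j _; rewrite mulr_sumr; apply: eq_bigr => n _.
by rewrite mulrA; congr (_ * _); rewrite mulrAC.
Qed.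

Definition coprime_dedekind_sum (R : realType) (q1 : nat)
    (chi1 chi2 : int -> R[i]) (h : int) (k d a : nat) : R[i] :=
  \sum_(j < d * k | coprime j d)
    (chi2 j%:Z)^* * (B1 (j%:R / (d * k)%:R : R))%:C
    * twisted_B1 R q1 chi1 ((h * (a * j)%:Z)%:~R / k%:R).

(** Replacing [j] by [i * k + j] changes neither [chi2], as [q2] divides [k], nor T, whose argument
    moves by the integer [h * i]. The sum over [i] is therefore the distribution relation of
    [B1]. *)
Lemma dedekind_sum_dilate (R : realType) (q1 q2 : nat)
    (chi1 chi2 : int -> R[i]) (h : int) (k d : nat) :
    dirichlet_character q2 chi2 -> (q2 %| k)%N -> (0 < k)%N -> (0 < d)%N ->
  dedekind_sum q1 chi1 chi2 h k =
  \sum_(j < d * k) (chi2 j%:Z)^* * (B1 (j%:R / (d * k)%:R : R))%:C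
                   * twisted_B1 R q1 chi1 ((h * j%:Z)%:~R / k%:R).
Proof.
move=> chi2P q2_k k_gt0 d_gt0.
have d0 : (d%:R : R) != 0 by rewrite pnatr_eq0 -lt0n.
have k0 : (k%:R : R) != 0 by rewrite pnatr_eq0 -lt0n.
rewrite dedekind_sumE (sum_ord_mul _ d k (fun j : nat =>
  (chi2 j%:Z)^* * (B1 (j%:R / (d * k)%:R : R))%:C
  * twisted_B1 R q1 chi1 ((h * j%:Z)%:~R / k%:R))).
rewrite exchange_big /=; apply: eq_bigr => j _.
have -> : B1 (j%:R / k%:R : R) = B1 (d%:R * (j%:R / (d * k)%:R)).
  by congr B1; rewrite natrM; field; rewrite d0 k0.
rewrite -sum_B1 // (rmorph_sum (real_complex R)) [_ * \sum_(_ < d) _]mulr_sumr.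
rewrite mulr_suml.
apply: eq_bigr => i _; congr (_^* * _%:C * _).
- apply: (dirichlet_character_mod _ _ _ chi2P).
  by rewrite PoszD opprD addrC subrK rpredN PoszM dvdz_mull.
- by congr B1; rewrite natrD !natrM; field; rewrite d0 k0.
- rewrite -(twisted_B1_addz _ _ _ _ (h * i%:Z)); congr (twisted_B1 _ _ _ _).
  by rewrite PoszD PoszM !(intrM, intrD); rewrite -!pmulrn; field.
Qed.

(** Sort the dilated sum by [a = gcdn j d]: the factor [a] comes out of [chi2] and cancels in the
    argument of [B1]. *)
Lemma dedekind_sum_split (R : realType) (q1 q2 : nat)
    (chi1 chi2 : int -> R[i]) (h : int) (k d : nat) :
    dirichlet_character q2 chi2 -> (q2 %| k)%N -> (0 < k)%N -> (0 < d)%N ->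
  dedekind_sum q1 chi1 chi2 h k =
  \sum_(a <- divisors d)
    (chi2 a%:Z)^* * coprime_dedekind_sum R q1 chi1 chi2 h k (d %/ a) a.
Proof.
move=> chi2P q2_k k_gt0 d_gt0; have [_ chi2M _] := chi2P.
rewrite (dedekind_sum_dilate _ _ _ _ _ _ _ _ chi2P q2_k k_gt0 d_gt0).
rewrite (sum_ord_gcdn _ _ _ (fun j : nat => (chi2 j%:Z)^*
  * (B1 (j%:R / (d * k)%:R : R))%:C
  * twisted_B1 R q1 chi1 ((h * j%:Z)%:~R / k%:R))) //.
rewrite big_seq [RHS]big_seq; apply: eq_bigr => a.
rewrite -dvdn_divisors // => a_d; have a_gt0 := dvdn_gt0 d_gt0 a_d.
rewrite mulr_sumr; apply: eq_bigr => j _.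
rewrite PoszM chi2M (rmorphM (@conjc R)) !mulrA; congr (_ * _%:C * _).
have -> : (d * k = a * (d %/ a * k))%N.
  by rewrite mulnA [(a * _)%N]mulnC divnK.
by rewrite !(natrM _ a) -mulf_div divff ?mul1r // pnatr_eq0 -lt0n.
Qed.

(** Only T depends on [b], and its argument is [a * h * j / (d * k) + b * j / d], so
    [sum_twisted_B1_gcdn] applies for each [j]. *)
Lemma sum_dedekind_sum_shift (R : realType) (q1 q2 : nat)
    (chi1 chi2 : int -> R[i]) (h : int) (k d a : nat) :
    (0 < q1)%N -> primitive_character q1 chi1 -> dirichlet_character q2 chi2 ->
    (0 < k)%N -> (0 < d)%N ->
  \sum_(b < d) dedekind_sum q1 chi1 chi2 (a%:Z * h + b%:Z * k%:Z) (d * k) =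
  \sum_(g <- divisors d) g%:R * (chi2 g%:Z)^* * chi1 (d %/ g)%N%:Z
    * coprime_dedekind_sum R q1 chi1 chi2 h k (d %/ g) a.
Proof.
move=> q1_gt0 prim1 [_ chi2M _] k_gt0 d_gt0.
have d0 : (d%:R : R) != 0 by rewrite pnatr_eq0 -lt0n.
have k0 : (k%:R : R) != 0 by rewrite pnatr_eq0 -lt0n.
transitivity (\sum_(j < d * k) (chi2 j%:Z)^* * (B1 (j%:R / (d * k)%:R : R))%:C
    * ((gcdn j d)%:R * chi1 (d %/ gcdn j d)%N%:Z
       * twisted_B1 R q1 chi1 ((d %/ gcdn j d)%:R
           * ((a%:Z * h * j%:Z)%:~R / (d * k)%:R)))).
  under eq_bigr do rewrite dedekind_sumE.
  rewrite exchange_big /=; apply: eq_bigr => j _.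
  rewrite -mulr_sumr; congr (_ * _).
  rewrite -sum_twisted_B1_gcdn //; apply: eq_bigr => b _.
  congr (twisted_B1 _ _ _ _).
  rewrite !(natrM, intrM, intrD) -!pmulrn; field.
  by rewrite d0 k0.
rewrite (sum_ord_gcdn _ _ _ (fun j : nat => (chi2 j%:Z)^*
  * (B1 (j%:R / (d * k)%:R : R))%:C
  * ((gcdn j d)%:R * chi1 (d %/ gcdn j d)%N%:Z
     * twisted_B1 R q1 chi1 ((d %/ gcdn j d)%:R
         * ((a%:Z * h * j%:Z)%:~R / (d * k)%:R))))) //.
rewrite big_seq [RHS]big_seq; apply: eq_bigr => g.
rewrite -dvdn_divisors // => g_d; have g_gt0 := dvdn_gt0 d_gt0 g_d.
have dE : d = (g * (d %/ g))%N by rewrite mulnC divnK.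
have f_gt0 : (0 < d %/ g)%N by rewrite divn_gt0 // dvdn_leq.
move: (d %/ g)%N dE f_gt0 => f dE f_gt0.
have f0 : (f%:R : R) != 0 by rewrite pnatr_eq0 -lt0n.
have g0 : (g%:R : R) != 0 by rewrite pnatr_eq0 -lt0n.
rewrite mulr_sumr; apply: eq_bigr => j j_f.
have -> : gcdn (g * j) d = g by rewrite dE -muln_gcdr (eqP j_f) muln1.
have -> : (d %/ g = f)%N by rewrite dE mulKn.
have -> : (g * j)%:R / (d * k)%:R = j%:R / (f * k)%:R :> R.
  by rewrite dE !natrM; field; rewrite f0 g0 k0.
have -> : f%:R * ((a%:Z * h * (g * j)%N%:Z)%:~R / (d * k)%:R)
    = (h * (a * j)%N%:Z)%:~R / k%:R :> R.
  by rewrite dE !PoszM !(natrM, intrM) -!pmulrn; field; rewrite f0 g0 k0.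
rewrite PoszM chi2M (rmorphM (@conjc R)); ring.
Qed.

(** * Comparison of the two expansions *)

Theorem theorem1p7 (R : realType) (q1 q2 : nat) (chi1 chi2 : int -> R[i])
  (hq1 : (1 < q1)%N) (hq2 : (1 < q2)%N)
  (hchi1 : primitive_character q1 chi1) (hchi2 : primitive_character q2 chi2)
  (hpar : chi1 (-1) * chi2 (-1) = 1)
  (h : int) (k n : nat) (hk : (0 < k)%N) (hn : (0 < n)%N)
  (hqk : (q1 * q2 %| k)%N) :
  \sum_(a <- divisors n | coprime a (q1 * q2))
     psi chi1 chi2 a%:Z *
     \sum_(b < n %/ a)
        dedekind_sum q1 chi1 chi2 (a%:Z * h + b%:Z * k%:Z) (n %/ a * k)
  = rho chi1 chi2 n * dedekind_sum q1 chi1 chi2 h k.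
Proof.
have [chi1P _] := hchi1; have [chi2P _] := hchi2.
have q1_gt0 : (0 < q1)%N by apply: ltnW.
have q2_k : (q2 %| k)%N by apply: dvdn_trans hqk; apply: dvdn_mull.
have [_ chi1M chi1_neq0] := chi1P; have [_ chi2M chi2_neq0] := chi2P.
have psi0 (a : nat) : ~~ coprime a (q1 * q2) -> psi chi1 chi2 a%:Z = 0.
  rewrite coprimeMr negb_and /psi.
  rewrite -[coprime a q1]/(coprimez a%:Z q1%:Z) -chi1_neq0 negbK.
  rewrite -[coprime a q2]/(coprimez a%:Z q2%:Z) -chi2_neq0 negbK.
  by move=> /orP[] /eqP ->; rewrite ?(rmorph0 (@conjc R)) ?mul0r ?mulr0.
pose C d a := coprime_dedekind_sum R q1 chi1 chi2 h k d a.
transitivity (\sum_(a <- divisors n) \sum_(g <- divisors (n %/ a))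
    psi chi1 chi2 a%:Z * (g%:R * (chi2 g%:Z)^* * chi1 (n %/ a %/ g)%N%:Z
                          * C (n %/ a %/ g)%N a)).
  rewrite big_mkcond big_seq [RHS]big_seq; apply: eq_bigr => a.
  rewrite -dvdn_divisors // => a_n; rewrite -mulr_sumr.
  have n_a : (0 < n %/ a)%N by rewrite divn_gt0 ?(dvdn_gt0 hn a_n) // dvdn_leq.
  case: ifPn => [_|/psi0 ->]; last by rewrite mul0r.
  by rewrite (sum_dedekind_sum_shift _ _ _ _ _ _ _ _ _ q1_gt0 hchi1 chi2P).
(* With [g] outermost, each [g] matches one term of [rho]; its factor [dedekind_sum] is split with
   [d = n %/ g]. *)
rewrite exchange_divisors // mulr_suml big_seq [RHS]big_seq.
apply: eq_bigr => g; rewrite -dvdn_divisors // => g_n.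
have n_g : (0 < n %/ g)%N by rewrite divn_gt0 ?(dvdn_gt0 hn g_n) // dvdn_leq.
rewrite (dedekind_sum_split _ _ _ _ _ _ _ _ chi2P q2_k hk n_g) mulr_sumr.
rewrite big_seq [RHS]big_seq; apply: eq_bigr => a.
rewrite -dvdn_divisors // => a_ng; rewrite divnAC /psi /C.
(* The factor [chi1 a] on the right supplies, with the conjugate of [chi2 a] from the splitting, the
   value [psi a] on the left. *)
have -> : chi1 (n %/ g)%N%:Z = chi1 a%:Z * chi1 (n %/ g %/ a)%N%:Z.
  by rewrite -chi1M -PoszM mulnC divnK.
ring.
Qed.
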